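(* Let $n\ge 2$ and $\hbar=2/\sqrt{n^2-1}$. Let $\mathfrak{g}=\mathfrak{su}(n)$ equipped with the scaled commutator bracket $\frac{1}{\hbar}[\cdot,\cdot]$. With $\Sigma=\mathfrak{u}(n)$, define the action $\rho$ of $\mathfrak{g}$ on $\Sigma$ by $\rho(P)B=\frac{1}{\hbar}[P,B]$, and define a 2-cocycle $b\colon\mathfrak{g}\times\mathfrak{g}\to\Sigma$ by $b(P_1,P_2)=-\frac{1}{\hbar}[P_1,P_2]$. Consider the Abelian extension of $\mathfrak{g}$ by $\Sigma$ determined by $\rho$ and $b$, i.e. $\mathfrak{su}(n)\times\mathfrak{u}(n)$ with the Lie bracket $$[(P_1,B_1),(P_2,B_2)]=\Big(\tfrac{1}{\hbar}[P_1,P_2],\ \rho(P_1)B_2-\rho(P_2)B_1+b(P_1,P_2)\Big).$$ Define an inner product on $\mathfrak{su}(n)\times\mathfrak{u}(n)$ by $$\big\langle(P_1,B_1),(P_2,B_2)\big\rangle=\operatorname{tr}(P_1\Delta_nP_2)-\operatorname{tr}(B_1B_2),$$ where $\Delta_n$ is the Hoppe--Yau Laplacian. Then the corresponding Euler--Arnold equation is $$\Delta_n\dot P+\frac{1}{\hbar}[P,\Delta_nP+B]=0,\qquad \dot B+\frac{1}{\hbar}[P,B]=0.$$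
   Context: $[\cdot,\cdot]$ applied to matrices is the matrix commutator; $\mathfrak{u}(n)$ is the space of skew-Hermitian $n\times n$ matrices and $\mathfrak{su}(n)$ its trace-free subspace. Hoppe--Yau Laplacian: let $s=\frac{n-1}{2}$ and index rows and columns by $-s,-s+1,\dots,s$. Let $S_1\in\mathfrak{u}(n)$ be the purely imaginary symmetric matrix whose only nonzero entries above the diagonal are $(S_1)_{j,j+1}=\frac{i}{2}\sqrt{s(s+1)-j(j+1)}$; let $S_2$ be the real antisymmetric matrix whose only nonzero entries above the diagonal are $(S_2)_{j,j+1}=\frac12\sqrt{s(s+1)-j(j+1)}$; let $S_3$ be the diagonal matrix with entries $(S_3)_{jj}=ij$. They satisfy $[S_1,S_2]=S_3$, $[S_2,S_3]=S_1$, $[S_3,S_1]=S_2$. Then $\Delta_nP=\sum_{\alpha=1}^3[S_\alpha,[S_\alpha,P]]$. Abelian extension: given a Lie algebra $\mathfrak{g}$, a $\mathfrak{g}$-module $\Sigma$ with action $\rho\colon\mathfrak{g}\to\operatorname{End}(\Sigma)$, and a bilinear skew-symmetric map $b\colon\mathfrak{g}\times\mathfrak{g}\to\Sigma$ satisfying the 2-cocycle condition $\sum_{\rm cyclic}b([v_1,v_2],v_3)=\sum_{\rm cyclic}\rho(v_1)b(v_2,v_3)$, the Abelian extension is $\mathfrak{g}\times\Sigma$ with Lie bracket $[(v_1,\sigma_1),(v_2,\sigma_2)]=([v_1,v_2],\rho(v_1)\sigma_2-\rho(v_2)\sigma_1+b(v_1,v_2))$. Euler--Arnold equation: for a Lie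 algebra with an inner product $\langle\cdot,\cdot\rangle$ (corresponding to a right-invariant metric on a Lie group), the convention is that the given Lie bracket is that of right-invariant vector fields, and $\operatorname{ad}_uv=-[u,v]$ is its negative. The operator $\operatorname{ad}^\star$ is defined by $\langle\operatorname{ad}^\star_uv,w\rangle=\langle v,\operatorname{ad}_uw\rangle$ for all $w$, and the Euler--Arnold equation for a curve $u(t)$ in the Lie algebra is $\dot u+\operatorname{ad}^\star_uu=0$. Here $u=(P,B)$. *)

(* Defs.v *)
From HB Require Import structures.
From mathcomp Require Import all_boot all_order all_algebra.
From mathcomp Require Import complex.
From mathcomp Require Import all_classical all_reals all_analysis.

Set Implicit Arguments.
Unset Strict Implicit.
Unset Printing Implicit Defensive.

Import Order.TTheory GRing.Theory Num.Theory.
Import numFieldTopology.Exports numFieldNormedType.Exports.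

Local Open Scope ring_scope.
Local Open Scope classical_set_scope.
Local Open Scope sesquilinear_scope.

Section LieAlgebra.
Variables (K : fieldType).

Definition is_bilinear (U V W : lmodType K) (f : U -> V -> W) : Prop :=
  (forall x, linear (f x)) /\ (forall y, linear (f ^~ y)).

Definition is_lie_bracket (g : lmodType K) (br : g -> g -> g) : Prop :=
  [/\ is_bilinear br,
      forall x, br x x = 0
    & forall x y z, br x (br y z) + br y (br z x) + br z (br x y) = 0].

Variables (g S : lmodType K).
Implicit Types (br : g -> g -> g) (rho : g -> S -> S) (b : g -> g -> S).

Definition is_lie_action br rho : Prop :=
  is_bilinear rho /\
  forall x y s, rho (br x y) s = rho x (rho y s) - rho y (rho x s).

Definition is_2cocycle br rho b : Prop :=
  [/\ is_bilinear b,
      forall x y, b x y = - b y x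
    & forall x y z,
        b (br x y) z + b (br y z) x + b (br z x) y
        = rho x (b y z) + rho y (b z x) + rho z (b x y)].

Definition abelian_ext_bracket br rho b (u v : g * S) : g * S :=
  (br u.1 v.1, rho u.1 v.2 - rho v.1 u.2 + b u.1 v.1).

End LieAlgebra.

Section EulerArnold.
Variables (R : realType).

Definition is_inner_product (g : lmodType R) (ip : g -> g -> R) : Prop :=
  [/\ is_bilinear (ip : g -> g -> R^o),
      forall u v, ip u v = ip v u
    & forall u, u != 0 -> 0 < ip u u].

(* The bracket is the one of right-invariant vector fields, whence the sign. *)
Definition ad (g : lmodType R) (br : g -> g -> g) (u v : g) : g := - br u v.

Definition is_ad_star (g : lmodType R) (ip : g -> g -> R) (br adstar : g -> g -> g)
    : Prop :=
  forall u v w, ip (adstar u v) w = ip v (ad br u w).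

Definition euler_arnold (g : normedModType R) (adstar : g -> g -> g)
    (I : set R) (u : R -> g) : Prop :=
  forall t, I t -> derivable u t 1 /\ derive1 u t + adstar (u t) (u t) = 0.

End EulerArnold.

(* [R[i]] and ['M[R[i]]_n] have no canonical [lmodType R] structure; this alias
   of ['M[R[i]]_n] carries the restriction of scalars to [R]. *)
Definition cmx (R : realType) (n : nat) : Type := 'M[R[i]]_n.

Section RealMatrixSpaces.
Variables (R : realType) (n : nat).

HB.instance Definition _ := GRing.Zmodule.on (cmx R n).

Definition cmx_scale (c : R) (A : cmx R n) : cmx R n := (c%:C)%C *: (A : 'M[R[i]]_n).

Lemma cmx_scaleA c d A : cmx_scale c (cmx_scale d A) = cmx_scale (c * d) A.
Proof. by rewrite /cmx_scale scalerA -rmorphM. Qed.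

Lemma cmx_scale1 : left_id 1 cmx_scale.
Proof. by move=> A; rewrite /cmx_scale rmorph1 scale1r. Qed.

Lemma cmx_scaleDr : right_distributive cmx_scale +%R.
Proof. by move=> c A B; rewrite /cmx_scale scalerDr. Qed.

Lemma cmx_scaleDl A : {morph cmx_scale^~ A : c d / c + d}.
Proof. by move=> c d; rewrite /cmx_scale rmorphD scalerDl. Qed.

HB.instance Definition _ := GRing.Zmodule_isLmodule.Build R (cmx R n)
  cmx_scaleA cmx_scale1 cmx_scaleDr cmx_scaleDl.

Definition skew_hermitian : {pred cmx R n} := fun A => A ^t* == - A.

Definition skew_hermitian_tr0 : {pred cmx R n} :=
  fun A => (A \in skew_hermitian) && (\tr A == 0).

Lemma skew_hermitianP (A : 'M[R[i]]_n) :
  reflect (A ^t* = - A) ((A : cmx R n) \in skew_hermitian).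
Proof. exact: eqP. Qed.

Lemma cmx_scaleE (c : R) (A : cmx R n) : c *: A = (c%:C)%C *: (A : 'M[R[i]]_n).
Proof. by []. Qed.

Lemma skew_hermitian_submod : submod_closed skew_hermitian.
Proof.
split=> [|c A B /skew_hermitianP hA /skew_hermitianP hB]; apply/skew_hermitianP.
  by rewrite trmx0 map_mx0 oppr0.
apply/matrixP => i j; move/matrixP/(_ i j): hA; move/matrixP/(_ i j): hB.
rewrite cmx_scaleE !mxE rmorphD rmorphM /= => -> ->.
rewrite -[Num.conj _]/((c%:C)^*)%C /= oppr0 -[(c +i* 0)%C]/(c%:C)%C.
by rewrite mulrN opprD.
Qed.

HB.instance Definition _ :=
  GRing.isSubmodClosed.Build R (cmx R n) skew_hermitian skew_hermitian_submod.

Lemma skew_hermitian_tr0_submod : submod_closed skew_hermitian_tr0.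
Proof.
split=> [|c A B /andP[hA /eqP tA] /andP[hB /eqP tB]]; apply/andP; split.
- exact: rpred0.
- by rewrite mxtrace0.
- by rewrite rpredD ?rpredZ.
- by rewrite cmx_scaleE mxtraceD mxtraceZ tA tB mulr0 addr0.
Qed.

HB.instance Definition _ :=
  GRing.isSubmodClosed.Build R (cmx R n) skew_hermitian_tr0 skew_hermitian_tr0_submod.

Record u_mx : Type := UMx { u_val :> cmx R n; _ : u_val \in skew_hermitian }.

HB.instance Definition _ := [isSub for u_val].
HB.instance Definition _ := [Choice of u_mx by <:].
HB.instance Definition _ := [SubChoice_isSubLmodule of u_mx by <:].

Record su_mx : Type := SuMx { su_val :> cmx R n; _ : su_val \in skew_hermitian_tr0 }.

HB.instance Definition _ := [isSub for su_val].
HB.instance Definition _ := [Choice of su_mx by <:].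
HB.instance Definition _ := [SubChoice_isSubLmodule of su_mx by <:].

(* Maximum of the moduli of the entries; it only serves to give u(n) and su(n)
   their usual topology, hence a derivative of curves. *)
Definition cmx_norm (A : cmx R n) : R := complex.Re `|A : 'M[R[i]]_n|.

Lemma cmx_normE A : ((cmx_norm A)%:C)%C = `|A : 'M[R[i]]_n|.
Proof. by rewrite /cmx_norm RRe_real ?normr_real. Qed.

Lemma cmx_normD A B : cmx_norm (A + B) <= cmx_norm A + cmx_norm B.
Proof.
have := @ler_normD _ 'M[R[i]]_n A B.
by rewrite -(cmx_normE (A + B)) -(cmx_normE A) -(cmx_normE B) -rmorphD lecR.
Qed.

Lemma cmx_normZ c A : cmx_norm (c *: A) = `|c| * cmx_norm A.
Proof.
apply: complexI; rewrite rmorphM cmx_normE cmx_scaleE normrZ.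
by rewrite normc_def /= expr0n /= addr0 sqrtr_sqr cmx_normE.
Qed.

Lemma cmx_norm_eq0 A : cmx_norm A = 0 -> A = 0.
Proof. by move=> h; apply/eqP; rewrite -normr_eq0 -cmx_normE h. Qed.

Lemma u_normD (A B : u_mx) :
  cmx_norm (\val (A + B)) <= cmx_norm (\val A) + cmx_norm (\val B).
Proof. by rewrite raddfD; exact: cmx_normD. Qed.
Lemma u_normZ (c : R) (A : u_mx) : cmx_norm (\val (c *: A)) = `|c| * cmx_norm (\val A).
Proof. by rewrite linearZ; exact: cmx_normZ. Qed.
Lemma u_norm_eq0 (A : u_mx) : cmx_norm (\val A) = 0 -> A = 0.
Proof. by move/cmx_norm_eq0 => h; apply: val_inj; rewrite h raddf0. Qed.

HB.instance Definition _ := @Lmodule_isNormed.Build R u_mx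
  (fun A => cmx_norm (\val A)) u_normD u_normZ u_norm_eq0.

Lemma su_normD (A B : su_mx) :
  cmx_norm (\val (A + B)) <= cmx_norm (\val A) + cmx_norm (\val B).
Proof. by rewrite raddfD; exact: cmx_normD. Qed.
Lemma su_normZ (c : R) (A : su_mx) : cmx_norm (\val (c *: A)) = `|c| * cmx_norm (\val A).
Proof. by rewrite linearZ; exact: cmx_normZ. Qed.
Lemma su_norm_eq0 (A : su_mx) : cmx_norm (\val A) = 0 -> A = 0.
Proof. by move/cmx_norm_eq0 => h; apply: val_inj; rewrite h raddf0. Qed.

HB.instance Definition _ := @Lmodule_isNormed.Build R su_mx
  (fun A => cmx_norm (\val A)) su_normD su_normZ su_norm_eq0.

Definition commutator (A B : cmx R n) : cmx R n := A *m B - B *m A.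

Lemma comm_skew (A B : cmx R n) : A \in skew_hermitian -> B \in skew_hermitian ->
  commutator A B \in skew_hermitian.
Proof.
move=> /skew_hermitianP hA /skew_hermitianP hB; apply/skew_hermitianP.
rewrite /commutator linearB /= map_mxB !trmx_mul !map_mxM hA hB.
by rewrite !mulNmx !mulmxN !opprK opprB.
Qed.

Lemma tr_comm (A B : cmx R n) : \tr (commutator A B) = 0.
Proof. by rewrite /commutator raddfB /= mxtrace_mulC subrr. Qed.

Lemma su_u_subproof (P : su_mx) : su_val P \in skew_hermitian.
Proof. by case: P => P /= /andP[]. Qed.

Definition su_u (P : su_mx) : u_mx := UMx (su_u_subproof P).

Lemma u_comm_subproof (A B : u_mx) : commutator A B \in skew_hermitian.
Proof. by apply: comm_skew; exact: valP. Qed.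

Definition u_comm (A B : u_mx) : u_mx := UMx (u_comm_subproof A B).

Lemma su_comm_subproof (P Q : su_mx) : commutator P Q \in skew_hermitian_tr0.
Proof.
by apply/andP; rewrite tr_comm eqxx; split=> //; apply: comm_skew; exact: su_u_subproof.
Qed.

Definition su_comm (P Q : su_mx) : su_mx := SuMx (su_comm_subproof P Q).

End RealMatrixSpaces.

Section HoppeYau.
Variables (R : realType) (n : nat).

Definition spin : R := (n%:R - 1) / 2.

(* Row [k : 'I_n] carries the label [j = -s + k] of the index set -s, ..., s. *)
Definition label (k : nat) : R := - spin + k%:R.

Definition ladder (k : nat) : R :=
  Num.sqrt (spin * (spin + 1) - label k * (label k + 1)).

Definition S1 : cmx R n := \matrix_(k, l)
  if l == k.+1 :> nat then (0 +i* (ladder k / 2))%C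
  else if k == l.+1 :> nat then (0 +i* (ladder l / 2))%C
  else 0.

Definition S2 : cmx R n := \matrix_(k, l)
  if l == k.+1 :> nat then ((ladder k / 2)%:C)%C
  else if k == l.+1 :> nat then - ((ladder l / 2)%:C)%C
  else 0.

Definition S3 : cmx R n := \matrix_(k, l)
  if k == l then (0 +i* label k)%C else 0.

Definition hoppe_yau (P : cmx R n) : cmx R n :=
  commutator S1 (commutator S1 P) + commutator S2 (commutator S2 P) + commutator S3 (commutator S3 P).

End HoppeYau.

Section Data.
Variables (R : realType) (n : nat).

Definition hbar : R := 2 / Num.sqrt (n%:R ^+ 2 - 1).

Definition su_bracket (P Q : su_mx R n) : su_mx R n := hbar^-1 *: su_comm P Q.

Definition rho (P : su_mx R n) (B : u_mx R n) : u_mx R n :=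
  hbar^-1 *: u_comm (su_u P) B.

Definition b_cocycle (P Q : su_mx R n) : u_mx R n :=
  - (hbar^-1 *: u_comm (su_u P) (su_u Q)).

Definition ext_bracket : su_mx R n * u_mx R n -> su_mx R n * u_mx R n ->
    su_mx R n * u_mx R n :=
  abelian_ext_bracket su_bracket rho b_cocycle.

Definition ip_formula (u v : su_mx R n * u_mx R n) : R[i] :=
  \tr ((u.1 : cmx R n) *m hoppe_yau v.1)
  - \tr ((u.2 : cmx R n) *m (v.2 : cmx R n)).

(* [ip_formula] is real-valued, so taking the real part only changes the type. *)
Definition ip (u v : su_mx R n * u_mx R n) : R := complex.Re (ip_formula u v).

End Data.

(* Main.v *)
From HB Require Import structures.
Require Import Defs.
From mathcomp Require Import all_boot all_order all_algebra.
From mathcomp Require Import complex ring zify.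
From mathcomp Require Import all_classical all_reals all_analysis.

(** The theorem is a computation of the coadjoint operator, made meaningful by the
    invertibility of the Laplacian on su(n).

    The extension is a Lie algebra because the action, the cocycle and the bracket
    are all scaled commutators up to sign: the action and cocycle identities are
    forms of the Jacobi identity ([mxbr_leibniz], [mxbr_cocycle]), and
    [abelian_ext_lie_bracket] assembles them.

    Invariance of the trace form, tr([A,B]D) = tr(A[B,D]) ([mxtrace_commA]), makes
    the Laplacian symmetric, and for skew-Hermitian P it gives
    tr(P Delta P) = sum over alpha of |[S_alpha,P]|^2 ([laplacian_energy]). This
    vanishes only if P commutes with the spin matrices. A matrix that commutes with
    S_3 is diagonal, since the entries of S_3 are distinct, and then commutation with
    S_2 makes it scalar, since the ladder coefficients do not vanish
    ([commute_spin_scalar]). A scalar matrix of trace zero is zero, so the form is an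
    inner product.

    The same argument shows that Delta is injective on all complex matrices of trace
    zero. Then A |-> Delta A + tr(A) 1 is an injective endomorphism of the space of
    all n x n matrices, hence surjective, so Delta is onto the matrices of trace zero;
    uniqueness of the solution makes it skew-Hermitian when the datum is
    ([laplacian_onto_skew]).

    Finally, for u = (P,B) and v = (Q,D), moving commutators across the trace
    ([mxtrace_ad_star]) shows that (M,N) = ad_star u v if and only if
    Delta M = ([P, Delta Q + D] + [D,B]) / hbar and N = [P,D] / hbar. Such an (M,N)
    exists because Delta is onto su(n), and it is unique because the inner product
    separates points. For u = v the commutator [D,B] vanishes, and applying the
    injective operator Delta to the first component of u' + ad_star u u = 0 gives the
    stated system ([euler_arnold_pointwise]); a curve in the product is
    differentiable exactly when both components are. *)

Set Implicit Arguments.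
Unset Strict Implicit.

Import Order.TTheory GRing.Theory Num.Theory.
Import numFieldTopology.Exports numFieldNormedType.Exports.

Local Open Scope ring_scope.
Local Open Scope classical_set_scope.
Local Open Scope sesquilinear_scope.

(** * Abelian extensions of Lie algebras *)

(** Proves that a sum in an abelian group is zero when its terms cancel in
    pairs: the opposite of the leading term is brought to the front, where the
    two disappear. *)
Ltac zmod_cancel :=
  rewrite ?opprD ?opprK -[LHS]addr0 -?addrA;
  repeat match goal with
  | |- - ?t + _ = 0 => rewrite !(addrCA _ t) addNKr
  | |- ?t + _ = 0 => rewrite !(addrCA _ (- t)) addKr
  end; try reflexivity.

(** Makes the plain hypotheses [linear f] of the bilinearity predicates usable
    for rewriting when [f] is only a partial application of an abstract map. *)
Lemma additive_of_linear (K : pzRingType) (U V : lmodType K) (f : U -> V) :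
  linear f -> [/\ {morph f : x y / x + y}, {morph f : x / - x} & f 0 = 0].
Proof.
move=> lf.
have f0 : f 0 = 0 by rewrite -[0 in LHS](subrr 0) addrC -scaleN1r lf scaleN1r addNr.
have fZ a x : f (a *: x) = a *: f x by rewrite -[a *: x]addr0 lf f0 addr0.
have fD x y : f (x + y) = f x + f y by rewrite -[x]scale1r lf !scale1r.
have fN x : f (- x) = - f x by rewrite -scaleN1r fZ scaleN1r.
by [].
Qed.

Section AbelianExtension.
Variables (K : fieldType) (g S : lmodType K).
Variables (br : g -> g -> g) (act : g -> S -> S) (b : g -> g -> S).

Lemma alternating_skew :
  is_lie_bracket br -> forall x y, br x y = - br y x.
Proof.
move=> [[lr ll] alt _] x y; apply/eqP; rewrite -addr_eq0; apply/eqP.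
have [Dr _ _] := additive_of_linear (lr (x + y)).
have := alt (x + y); rewrite Dr.
have [Dl _ _] := additive_of_linear (ll x); rewrite Dl.
have [Dl' _ _] := additive_of_linear (ll y); rewrite Dl'.
by rewrite !alt add0r addr0 addrC.
Qed.

(** In the [S]-component of the Jacobi sum the terms quadratic in the action
    cancel because [act] is an action, and what remains is exactly the 2-cocycle
    identity. That [b] vanishes on the diagonal is a separate hypothesis because in
    characteristic 2 it does not follow from skew symmetry. *)
Lemma abelian_ext_lie_bracket :
  is_lie_bracket br -> is_lie_action br act -> is_2cocycle br act b ->
  (forall x, b x x = 0) -> is_lie_bracket (abelian_ext_bracket br act b).
Proof.
move=> brP [[actr actl] actP] [[bl br'] bN bC] bxx.
have brN := alternating_skew brP.
case: (brP) => -[brr brl] brxx brJ.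
split; first split.
- move=> x k y z; congr (_, _) => /=; first exact: brr.
  rewrite actr actl bl !scalerDr scalerN; apply/eqP; rewrite -subr_eq0; apply/eqP.
  by zmod_cancel.
- move=> x k y z; congr (_, _) => /=; first exact: brl.
  rewrite actr actl br' !scalerDr scalerN; apply/eqP; rewrite -subr_eq0; apply/eqP.
  by zmod_cancel.
- by move=> x; rewrite /abelian_ext_bracket brxx subrr bxx addr0.
- move=> x y z; congr (_, _) => /=; first exact: brJ.
  have D p := additive_of_linear (actr p).
  have [[[Dx Nx _] [Dy Ny _]] [Dz Nz _]] := (D x.1, D y.1, D z.1).
  have := bC x.1 y.1 z.1; rewrite (bN (br x.1 y.1)) (bN (br y.1 z.1)) (bN (br z.1 x.1)).
  move/esym/eqP; rewrite -subr_eq0 => /eqP bJ.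
  rewrite !actP !Dx !Nx !Dy !Ny !Dz !Nz -[RHS]bJ.
  by apply/eqP; rewrite -subr_eq0; apply/eqP; zmod_cancel.
Qed.

End AbelianExtension.

(** * Commutators of matrices and the trace *)

Section Commutators.
Variables (K : comNzRingType) (n : nat).
Implicit Types (A B D : 'M[K]_n).

Definition mxcomm A B : 'M[K]_n := A *m B - B *m A.

Lemma mxcommC A B : mxcomm A B = - mxcomm B A.
Proof. by rewrite /mxcomm opprB. Qed.

Lemma mxcommxx A : mxcomm A A = 0.
Proof. exact: subrr. Qed.

Lemma mxcomm_linear A : linear (mxcomm A).
Proof.
move=> c B D; rewrite /mxcomm mulmxDr mulmxDl -scalemxAr -scalemxAl scalerBr.
by rewrite opprD addrACA.
Qed.

HB.instance Definition _ A :=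
  GRing.isLinear.Build K _ _ _ (mxcomm A) (mxcomm_linear A).

Lemma mxcomm_jacobi A B D :
  mxcomm A (mxcomm B D) + mxcomm B (mxcomm D A) + mxcomm D (mxcomm A B) = 0.
Proof. by rewrite /mxcomm !mulmxBr !mulmxBl !mulmxA; zmod_cancel. Qed.

Lemma mxtrace_comm A B : \tr (mxcomm A B) = 0.
Proof. by rewrite /mxcomm raddfB /= mxtrace_mulC subrr. Qed.

(** Invariance of the trace form: it is what moves a commutator from one factor
    to the other, and hence computes every adjoint below. *)
Lemma mxtrace_commA A B D : \tr (mxcomm A B *m D) = \tr (A *m mxcomm B D).
Proof.
rewrite /mxcomm mulmxBl mulmxBr !raddfB /= !mulmxA; congr (_ - _).
by rewrite mxtrace_mulC mulmxA mxtrace_mulC mulmxA.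
Qed.

(** The action, the cocycle and the bracket of the extension are all, up to sign,
    this one scaled commutator. *)
Definition mxbr c A B : 'M[K]_n := c *: mxcomm A B.

Lemma mxtrace_mxbr c A B : \tr (mxbr c A B) = 0.
Proof. by rewrite mxtraceZ mxtrace_comm mulr0. Qed.

Lemma mxbrC c A B : mxbr c A B = - mxbr c B A.
Proof. by rewrite /mxbr mxcommC scalerN. Qed.

Lemma mxbrxx c A : mxbr c A A = 0.
Proof. by rewrite /mxbr mxcommxx scaler0. Qed.

Lemma mxbr_linear c A : linear (mxbr c A).
Proof. by move=> k B D; rewrite /mxbr linearP scalerDr !scalerA mulrC. Qed.

Lemma mxbr_linear_l c B : linear (fun A => mxbr c A B).
Proof. by move=> k A D; rewrite mxbrC mxbr_linear opprD -scalerN -!(mxbrC c _ B). Qed.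

Lemma mxbr_jacobi c A B D :
  mxbr c A (mxbr c B D) + mxbr c B (mxbr c D A) + mxbr c D (mxbr c A B) = 0.
Proof.
rewrite /mxbr !(linearZZ (mxcomm _)) !scalerA -!scalerDr.
by rewrite mxcomm_jacobi scaler0.
Qed.

Lemma mxbrNr c A B : mxbr c A (- B) = - mxbr c A B.
Proof. by have [_ -> _] := additive_of_linear (mxbr_linear c A). Qed.

Lemma mxbr_jacobi_l c A B D :
  mxbr c (mxbr c A B) D + mxbr c (mxbr c B D) A + mxbr c (mxbr c D A) B = 0.
Proof.
rewrite (mxbrC c (mxbr c A B)) (mxbrC c (mxbr c B D)) (mxbrC c (mxbr c D A)).
by rewrite -!opprD -addrA addrC mxbr_jacobi oppr0.
Qed.

Lemma mxbr_cocycle c A B D :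
  - mxbr c (mxbr c A B) D - mxbr c (mxbr c B D) A - mxbr c (mxbr c D A) B =
  mxbr c A (- mxbr c B D) + mxbr c B (- mxbr c D A) + mxbr c D (- mxbr c A B).
Proof. by rewrite !mxbrNr -!opprD mxbr_jacobi mxbr_jacobi_l. Qed.

Lemma mxbr_leibniz c A B D :
  mxbr c (mxbr c A B) D = mxbr c A (mxbr c B D) - mxbr c B (mxbr c A D).
Proof.
rewrite (mxbrC c (mxbr c A B)) (mxbrC c A D) mxbrNr opprK; apply/esym/eqP.
by rewrite -addr_eq0 mxbr_jacobi.
Qed.

(** With [L] standing for the Laplacian
    of the first component of the second argument, the right-hand side is the
    pairing of [(L, D)] with the adjoint action of [(P, B)] on [(X, Y)]; by
    invariance of the trace all commutators containing [X] and [Y] are moved off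
    them, which leaves the left-hand side. *)
Lemma mxtrace_ad_star c (P B L D X Y : 'M[K]_n) :
  \tr (c *: (mxcomm P (L + D) + mxcomm D B) *m X) - \tr (mxbr c P D *m Y) =
  \tr (L *m - mxbr c P X) - \tr (D *m - (mxbr c P Y - mxbr c X B - mxbr c P X)).
Proof.
have := (mxtrace_commA L P X, mxtrace_commA D P X, mxtrace_commA D P Y,
  mxtrace_commA D B X).
rewrite /mxbr (linearD (mxcomm P)) /= (mxcommC P L) (mxcommC P D) (mxcommC X B).
move: (mxcomm L P) (mxcomm D P) (mxcomm D B) (mxcomm P X) (mxcomm P Y)
  (mxcomm B X) => LP DP DB PX PY BX [[[LPX DPX] DPY] DBX].
rewrite !(scalerDr, scalerN, mulmxDr, mulmxDl, mulmxN, mulNmx, opprD, opprK).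
rewrite -!scalemxAl -!scalemxAr !(mxtraceD, raddfN, mxtraceZ) /=.
rewrite !(mxtraceZ, LPX, DPX, DPY, DBX).
ring.
Qed.

End Commutators.

(** * Adjoints and positivity of the Frobenius form *)

Section Frobenius.
Variables (C : numClosedFieldType) (n : nat).
Implicit Types (A B S : 'M[C]_n).

Lemma adjmxM A B : (A *m B) ^t* = B ^t* *m A ^t*.
Proof. by rewrite trmx_mul map_mxM. Qed.

Lemma adjmxD A B : (A + B) ^t* = A ^t* + B ^t*.
Proof. by rewrite linearD /= map_mxD. Qed.

Lemma mxtrace_adj A : \tr (A ^t*) = (\tr A)^*.
Proof. by rewrite /mxtrace rmorph_sum; apply: eq_bigr => i _; rewrite !mxE. Qed.

(** Commuting with a skew-Hermitian matrix is a real operation; this is why the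
    Laplacian preserves skew-Hermitian matrices. *)
Lemma mxcomm_adj S B : S ^t* = - S -> (mxcomm S B) ^t* = mxcomm S (B ^t*).
Proof.
move=> sS; rewrite /mxcomm linearB /= map_mxB !adjmxM sS.
by rewrite mulNmx mulmxN opprK addrC.
Qed.

Lemma skew_scaled_mxcomm c A B : c \is Num.real ->
  A ^t* = - A -> B ^t* = - B -> (mxbr c A B) ^t* = - mxbr c A B.
Proof.
move=> /CrealP c_real sA sB.
have -> : (mxbr c A B) ^t* = c *: (mxcomm A B) ^t*.
  by apply/matrixP => i j; rewrite !mxE rmorphM /= c_real.
by rewrite (mxcomm_adj _ sA) sB (linearN (mxcomm A)) /= scalerN.
Qed.

Lemma mxtrace_adjmul A : \tr (A ^t* *m A) = \sum_i \sum_j `|A i j| ^+ 2.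
Proof.
rewrite exchange_big; apply: eq_bigr => j _; rewrite mxE; apply: eq_bigr => i _.
by rewrite !mxE normCKC.
Qed.

Lemma mxtrace_adjmul_ge0 A : 0 <= \tr (A ^t* *m A).
Proof.
by rewrite mxtrace_adjmul; do 2!apply: sumr_ge0 => ? _; exact: exprn_ge0.
Qed.

Lemma mxtrace_adjmul_eq0 A : \tr (A ^t* *m A) = 0 -> A = 0.
Proof.
rewrite mxtrace_adjmul => /eqP; rewrite psumr_eq0; last first.
  by move=> i _; apply: sumr_ge0 => j _; exact: exprn_ge0.
move=> /allP A0; apply/matrixP => i j; rewrite mxE.
have /= := A0 i (mem_index_enum _); rewrite psumr_eq0; last first.
  by move=> j' _; exact: exprn_ge0.
by move=> /allP/(_ j (mem_index_enum _)) /=; rewrite expf_eq0 normr_eq0 => /eqP.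
Qed.

End Frobenius.

(** * The Laplacian of a family of skew-Hermitian matrices *)

(** Only two properties of the spin matrices matter: they are skew-Hermitian, and
    (for definiteness and invertibility) only scalar matrices commute with all of
    them. The theory is therefore developed for any such finite family. *)
Section Laplacian.
Variables (C : numClosedFieldType) (n : nat) (I : finType) (S : I -> 'M[C]_n).
Hypothesis S_skew : forall i, (S i) ^t* = - S i.
Implicit Types (A B Z : 'M[C]_n).

Definition laplacian A : 'M[C]_n := \sum_i mxcomm (S i) (mxcomm (S i) A).

Lemma laplacian_linear : linear laplacian.
Proof.
move=> c A B; rewrite /laplacian scaler_sumr -big_split /=.
by apply: eq_bigr => i _; rewrite !linearP.
Qed.

HB.instance Definition _ := GRing.isLinear.Build C _ _ _ laplacian laplacian_linear.

Lemma laplacianD A B : laplacian (A + B) = laplacian A + laplacian B.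
Proof. exact: linearD. Qed.

Lemma laplacian0 : laplacian 0 = 0.
Proof. exact: linear0. Qed.

Lemma mxtrace_laplacian A : \tr (laplacian A) = 0.
Proof. by rewrite raddf_sum big1 //= => i _; rewrite mxtrace_comm. Qed.

Lemma laplacian_adj A : (laplacian A) ^t* = laplacian (A ^t*).
Proof.
rewrite /laplacian raddf_sum raddf_sum; apply: eq_bigr => i _ /=.
by rewrite !(mxcomm_adj _ (S_skew i)).
Qed.

Lemma laplacian_sym A B : \tr (A *m laplacian B) = \tr (laplacian A *m B).
Proof.
rewrite mulmx_sumr mulmx_suml !raddf_sum; apply: eq_bigr => i _ /=.
by rewrite -!mxtrace_commA 2!(mxcommC _ (S i)) !(linearN, mulNmx) opprK.
Qed.

(** Integration by parts: the quadratic form of the Laplacian is minus a sum of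
    squared Frobenius norms of commutators. *)
Lemma laplacian_energy A : - \tr (A ^t* *m laplacian A) =
  \sum_i \tr ((mxcomm (S i) A) ^t* *m mxcomm (S i) A).
Proof.
apply: (canLR opprK).
rewrite mulmx_sumr raddf_sum -sumrN; apply: eq_bigr => i _ /=.
by rewrite -mxtrace_commA mxcommC -(mxcomm_adj _ (S_skew i)) mulNmx raddfN.
Qed.

Lemma laplacian_energy_ge0 A : 0 <= - \tr (A ^t* *m laplacian A).
Proof.
by rewrite laplacian_energy; apply: sumr_ge0 => i _; exact: mxtrace_adjmul_ge0.
Qed.

(** The complex bilinear form whose restriction to pairs of skew-Hermitian matrices
    is the inner product. It takes matrices rather than elements of su(n) x u(n) so
    that all its properties can be proved over an abstract closed field. *)
Definition energy_form A B A' B' : C :=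
  \tr (A *m laplacian A') - \tr (B *m B').

Lemma energy_formC A B A' B' : energy_form A B A' B' = energy_form A' B' A B.
Proof.
by rewrite /energy_form laplacian_sym mxtrace_mulC (mxtrace_mulC B).
Qed.

Lemma energy_form_linear A B k A1 B1 A2 B2 :
  energy_form A B (k *: A1 + A2) (k *: B1 + B2) =
  k * energy_form A B A1 B1 + energy_form A B A2 B2.
Proof.
rewrite /energy_form linearP !mulmxDr -!scalemxAr !mxtraceD !mxtraceZ.
ring.
Qed.

Lemma energy_form_real A B A' B' : A ^t* = - A -> B ^t* = - B ->
  A' ^t* = - A' -> B' ^t* = - B' -> energy_form A B A' B' \is Num.real.
Proof.
have mul_real X Y : X ^t* = - X -> Y ^t* = - Y -> \tr (X *m Y) \is Num.real.
  move=> sX sY; apply/CrealP; rewrite -mxtrace_adj adjmxM sX sY.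
  by rewrite mulNmx mulmxN opprK mxtrace_mulC.
move=> sA sB sA' sB'; apply: rpredB; apply: mul_real => //.
by rewrite laplacian_adj sA' raddfN.
Qed.

Lemma energy_formE A B : A ^t* = - A -> B ^t* = - B ->
  energy_form A B A B = - \tr (A ^t* *m laplacian A) + \tr (B ^t* *m B).
Proof. by move=> -> ->; rewrite !mulNmx !raddfN opprK. Qed.

Lemma energy_form_ge0 A B : A ^t* = - A -> B ^t* = - B ->
  0 <= energy_form A B A B.
Proof.
move=> sA sB; rewrite energy_formE //.
by rewrite addr_ge0 ?laplacian_energy_ge0 ?mxtrace_adjmul_ge0.
Qed.

(** The right-hand side of the equation that determines the first component of the
    coadjoint operator lies again in su(n). *)
Lemma ad_star_target_skew c P B Q D : c \is Num.real ->
  P ^t* = - P -> B ^t* = - B -> Q ^t* = - Q -> D ^t* = - D ->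
  let Z := c *: (mxcomm P (laplacian Q + D) + mxcomm D B) in
  Z ^t* = - Z /\ \tr Z = 0.
Proof.
move=> c_real sP sB sQ sD Z; have -> : Z = mxbr c P (laplacian Q + D) + mxbr c D B.
  exact: scalerDr.
split; last by rewrite mxtraceD !mxtrace_mxbr addr0.
rewrite adjmxD !skew_scaled_mxcomm ?opprD //.
by rewrite adjmxD laplacian_adj sQ sD raddfN.
Qed.

Lemma energy_form_ad_star c P B Q D M N X Y :
  laplacian M = c *: (mxcomm P (laplacian Q + D) + mxcomm D B) ->
  N = mxbr c P D ->
  energy_form M N X Y =
  energy_form Q D (- mxbr c P X) (- (mxbr c P Y - mxbr c X B - mxbr c P X)).
Proof.
move=> LM ->; rewrite /energy_form [in LHS]laplacian_sym [in RHS]laplacian_sym LM.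
exact: mxtrace_ad_star.
Qed.

Hypothesis n_gt0 : (0 < n)%N.
Hypothesis S_irr : forall A, (forall i, mxcomm (S i) A = 0) -> is_scalar_mx A.

(** The energy vanishes only if all commutators with the family do; then the matrix
    is scalar, and a scalar matrix of trace zero is zero. *)
Lemma laplacian_energy_eq0 A :
  \tr A = 0 -> \tr (A ^t* *m laplacian A) = 0 -> A = 0.
Proof.
move=> trA /eqP; rewrite -oppr_eq0 laplacian_energy psumr_eq0; last first.
  by move=> i _; exact: mxtrace_adjmul_ge0.
move=> /allP comm0.
have /is_scalar_mxP[c Ac] : is_scalar_mx A.
  apply: S_irr => i; apply: mxtrace_adjmul_eq0; apply/eqP.
  exact: comm0 (mem_index_enum i).
move: trA; rewrite Ac mxtrace_scalar => /eqP; rewrite mulrn_eq0.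
by rewrite (gtn_eqF n_gt0) => /eqP ->; rewrite raddf0.
Qed.

Lemma energy_form_eq0 A B : A ^t* = - A -> B ^t* = - B -> \tr A = 0 ->
  energy_form A B A B = 0 -> A = 0 /\ B = 0.
Proof.
move=> sA sB trA /eqP; rewrite energy_formE //.
rewrite paddr_eq0 ?laplacian_energy_ge0 ?mxtrace_adjmul_ge0 // oppr_eq0.
case/andP => /eqP A0 /eqP B0; split; first exact: laplacian_energy_eq0.
exact: mxtrace_adjmul_eq0.
Qed.

Lemma laplacian_inj0 A : \tr A = 0 -> laplacian A = 0 -> A = 0.
Proof.
by move=> trA LA; apply: laplacian_energy_eq0; rewrite // LA mulmx0 mxtrace0.
Qed.

(** The Laplacian corrected on its kernel. On all matrices the Laplacian kills the
    scalars and misses everything of nonzero trace; adding the trace as a scalar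
    matrix makes it injective, hence bijective by finite dimension. *)
Definition shifted_laplacian A : 'M[C]_n := laplacian A + (\tr A)%:M.

Lemma shifted_laplacian_linear : linear shifted_laplacian.
Proof.
move=> c A B; rewrite /shifted_laplacian linearP mxtraceD mxtraceZ raddfD /=.
by rewrite -scale_scalar_mx scalerDr addrACA.
Qed.

HB.instance Definition _ := GRing.isLinear.Build C _ _ _ shifted_laplacian
  shifted_laplacian_linear.

Lemma shifted_laplacian_tr0 A : \tr (shifted_laplacian A) = 0 -> \tr A = 0.
Proof.
rewrite mxtraceD mxtrace_laplacian add0r mxtrace_scalar => /eqP.
by rewrite mulrn_eq0 (gtn_eqF n_gt0) => /eqP.
Qed.

(** The trace of [shifted_laplacian A] is a nonzero multiple of the trace of [A], so
    the preimage of a matrix of trace zero has trace zero, where the correction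
    vanishes. *)
Lemma laplacian_onto Z : \tr Z = 0 -> exists2 A, laplacian A = Z & \tr A = 0.
Proof.
move=> trZ; pose T := linfun shifted_laplacian.
have kT : lker T == 0%VS.
  rewrite -subv0; apply/subvP => A; rewrite memv_ker lfunE /= memv0 => /eqP TA0.
  have trA : \tr A = 0 by apply: shifted_laplacian_tr0; rewrite TA0 mxtrace0.
  apply/eqP/laplacian_inj0 => //.
  by move: TA0; rewrite /shifted_laplacian trA raddf0 addr0.
have TZ : shifted_laplacian (T^-1%VF Z) = Z.
  by rewrite -[LHS](lfunE shifted_laplacian) lker0_lfunVK.
have trA : \tr (T^-1%VF Z) = 0 by apply: shifted_laplacian_tr0; rewrite TZ.
by exists (T^-1%VF Z) => //; rewrite -[RHS]TZ /shifted_laplacian trA raddf0 addr0.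
Qed.

(** If [A] is a traceless solution then [- A ^t*] is one as well, so the two agree
    by injectivity. *)
Lemma laplacian_onto_skew Z : Z ^t* = - Z -> \tr Z = 0 ->
  exists A, [/\ laplacian A = Z, A ^t* = - A & \tr A = 0].
Proof.
move=> skZ /laplacian_onto[A LA trA]; exists A; split=> //.
apply/eqP; rewrite -addr_eq0; apply/eqP/laplacian_inj0.
  by rewrite mxtraceD mxtrace_adj trA rmorph0 addr0.
by rewrite raddfD /= -laplacian_adj LA skZ addNr.
Qed.

End Laplacian.

Lemma laplacian3E (C : numClosedFieldType) n (S1 S2 S3 A : 'M[C]_n) :
  laplacian (fun i : 'I_3 => nth 0 [:: S1; S2; S3] i) A =
  mxcomm S1 (mxcomm S1 A) + mxcomm S2 (mxcomm S2 A) + mxcomm S3 (mxcomm S3 A).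
Proof. by rewrite /laplacian !big_ord_recl big_ord0 addr0 addrA. Qed.

(** * The spin matrices *)

Section Spin.
Variables (R : realType) (n : nat).
Local Notation C := (R[i]).
Local Notation M := ('M[C]_n).
Implicit Types (A B S Z : M).

Lemma conj_imaginary (x : R) : Num.conj (0 +i* x)%C = - (0 +i* x)%C :> C.
Proof. by apply/eqP; rewrite eq_complex /= oppr0 !eqxx. Qed.

Lemma S1_skew : (S1 R n : M) ^t* = - (S1 R n : M).
Proof.
apply/matrixP => k l; rewrite !mxE.
case: eqP => kl; case: eqP => lk; rewrite ?conj_imaginary ?rmorph0 ?oppr0 //.
by exfalso; lia.
Qed.

Lemma S2_skew : (S2 R n : M) ^t* = - (S2 R n : M).
Proof.
apply/matrixP => k l; rewrite !mxE.
have conjR (x : R) : Num.conj (x%:C)%C = (x%:C)%C :> C.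
  by apply/eqP; rewrite eq_complex /= oppr0 !eqxx.
case: eqP => kl; case: eqP => lk; rewrite ?rmorphN ?conjR ?opprK ?rmorph0 ?oppr0 //.
  by exfalso; lia.
by congr (- _); exact: conjR.
Qed.

Lemma S3_skew : (S3 R n : M) ^t* = - (S3 R n : M).
Proof.
apply/matrixP => k l; rewrite !mxE eq_sym.
by case: eqP => [->|_]; rewrite ?conj_imaginary ?rmorph0 ?oppr0.
Qed.

Lemma S3_diag : S3 R n = diag_mx (\row_k (0 +i* label R n k)%C) :> M.
Proof. by apply/matrixP => k l; rewrite !mxE; case: eqP. Qed.

(** The diagonal entries of [S3] are pairwise distinct. *)
Lemma commute_S3_diag A : mxcomm (S3 R n) A = 0 -> is_diag_mx A.
Proof.
move=> /matrixP cA; apply/is_diag_mxP => k l kl.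
have := cA k l; rewrite /mxcomm S3_diag mul_diag_mx mul_mx_diag !mxE.
rewrite mulrC -mulrBr => /eqP; rewrite mulf_eq0 => /orP[/eqP //|].
rewrite subr_eq0 => /eqP[] /addrI/eqP; rewrite eqr_nat => /eqP E.
by rewrite E eqxx in kl.
Qed.

(** With [j = -s + k] the radicand is [(n - 1 - k) * (k + 1)]. *)
Lemma ladder_gt0 k : (k.+1 < n)%N -> 0 < ladder R n k.
Proof.
move=> kn; rewrite sqrtr_gt0 /label /spin.
have -> : (n%:R - 1) / 2 * ((n%:R - 1) / 2 + 1) -
   (- ((n%:R - 1) / 2) + k%:R) * (- ((n%:R - 1) / 2) + k%:R + 1)
   = (n%:R - k.+1%:R) * k.+1%:R :> R by field.
by rewrite mulr_gt0 ?subr_gt0 ?ltr_nat.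
Qed.

(** A matrix commuting with [S3] is diagonal; commutation with [S2] compares
    neighbouring diagonal entries through the nonzero ladder coefficients, so that
    they all agree. *)
Lemma commute_spin_scalar A : (0 < n)%N ->
  mxcomm (S2 R n) A = 0 -> mxcomm (S3 R n) A = 0 -> is_scalar_mx A.
Proof.
move=> n_gt0 /[swap] /commute_S3_diag/diag_mxP[d ->] /matrixP cA.
have step k (hk : (k < n)%N) (hk1 : (k.+1 < n)%N) :
  d ord0 (Ordinal hk1) = d ord0 (Ordinal hk).
  have := cA (Ordinal hk) (Ordinal hk1).
  rewrite /mxcomm mul_diag_mx mul_mx_diag !mxE /= eqxx mulrC -mulrBl.
  move/eqP; rewrite mulf_eq0 subr_eq0 => /orP[/eqP //|].
  by rewrite fmorph_eq0 mulf_eq0 (gt_eqF (ladder_gt0 hk1)) invr_eq0 pnatr_eq0.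
have const k (hk : (k < n)%N) : d ord0 (Ordinal hk) = d ord0 (Ordinal n_gt0).
  elim: k hk => [|k IHk] hk; first by congr (d _ _); exact: val_inj.
  by rewrite (step k (ltnW hk)) IHk.
apply/is_scalar_mxP; exists (d ord0 (Ordinal n_gt0)).
apply/matrixP => i j; rewrite !mxE; case: eqP => // _.
by case: i => i hi; rewrite const.
Qed.

Definition spin_matrix (i : 'I_3) : M :=
  nth 0 [:: S1 R n : M; S2 R n : M; S3 R n : M] i.

Lemma spin_matrix_skew i : (spin_matrix i) ^t* = - spin_matrix i.
Proof.
by case: i => -[|[|[|//]]] ?; [exact: S1_skew | exact: S2_skew | exact: S3_skew].
Qed.

Lemma spin_matrix_irr A : (0 < n)%N ->
  (forall i, mxcomm (spin_matrix i) A = 0) -> is_scalar_mx A.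
Proof.
move=> n_gt0 cA; apply: commute_spin_scalar => //.
  exact: (cA (@Ordinal 3 1 isT)).
exact: (cA (@Ordinal 3 2 isT)).
Qed.

Lemma hoppe_yauE A : hoppe_yau (A : cmx R n) = laplacian spin_matrix A :> M.
Proof. by rewrite laplacian3E. Qed.

End Spin.

(** * Derivatives of curves in a product *)

Section CurvesInProduct.
Variables (R : realType) (V W : normedModType R) (f : R -> V) (g : R -> W).
Local Notation pair_curve := (fun t : R => (f t, g t)).

Lemma is_derive_pairP (t : R) (df : V) (dg : W) :
  is_derive t 1 pair_curve (df, dg) <-> is_derive t 1 f df /\ is_derive t 1 g dg.
Proof.
pose q (U : normedModType R) (k : R -> U) (h : R) : U :=
  h^-1 *: ((k \o shift t) (h *: 1) - k t).
have qcvg (U : normedModType R) (k : R -> U) dk :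
    is_derive t 1 k dk <-> q U k h @[h --> 0^'] --> dk.
  split=> [[kt <-] //|kt].
  by split; [apply: cvgP kt | apply: cvg_lim kt; exact: norm_hausdorff].
rewrite !qcvg; split=> [fg|[ft gt]].
  have cfst : fst x @[x --> (df, dg)] --> df by exact: cvg_fst.
  have csnd : snd x @[x --> (df, dg)] --> dg by exact: cvg_snd.
  by split; [exact: (cvg_comp _ fst fg cfst) | exact: (cvg_comp _ snd fg csnd)].
exact: cvg_pair ft gt.
Qed.

Lemma derivable_pairP (t : R) :
  derivable pair_curve t 1 <-> derivable f t 1 /\ derivable g t 1.
Proof.
split=> [/derivableP fg|[/derivableP ft /derivableP gt]].
  have : is_derive t 1 pair_curve ('D_1 pair_curve t) by [].
  rewrite [X in is_derive _ _ _ X]surjective_pairing => /is_derive_pairP[ft gt].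
  by split; exact: ex_derive.
by have /is_derive_pairP[] : is_derive t 1 f ('D_1 f t) /\ is_derive t 1 g ('D_1 g t).
Qed.

Lemma derive1_pair (t : R) : derivable f t 1 -> derivable g t 1 ->
  derive1 pair_curve t = (derive1 f t, derive1 g t).
Proof.
move=> /derivableP ft /derivableP gt; rewrite !derive1E.
by have /is_derive_pairP[] : is_derive t 1 f ('D_1 f t) /\ is_derive t 1 g ('D_1 g t).
Qed.

End CurvesInProduct.

(** * The inner product and the coadjoint operator on su(n) x u(n) *)

Lemma inner_product_inj (R : realType) (g : lmodType R) (ip : g -> g -> R) v w :
  is_inner_product ip -> (forall x, ip v x = ip w x) -> v = w.
Proof.
move=> [[_ ipl] _ ip_pos] vw; apply/eqP; rewrite -subr_eq0; apply/negPn/negP.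
have := ipl (v - w) (-1) w v; rewrite /= scaleN1r [- w + v]addrC => ipvw.
by move=> /ip_pos; rewrite ipvw vw scaleN1r addNr ltxx.
Qed.

Section Extension.
Variables (R : realType) (n : nat).
Local Notation C := (R[i]).
Local Notation M := ('M[C]_n).
Local Notation su := (su_mx R n).
Local Notation u := (u_mx R n).
Local Notation hinv := (((hbar R n)^-1)%:C)%C.
Local Notation mx A := (\val A : M).
Local Notation form := (energy_form (@spin_matrix R n)).
Local Notation L := (laplacian (@spin_matrix R n)).

(** These identities pass from the real spaces su(n) and u(n) to complex matrices,
    where real scalars act through the embedding of the reals. *)
Lemma su_valP k (P Q : su) : mx (k *: P + Q) = (k%:C)%C *: mx P + mx Q.
Proof. by rewrite linearP. Qed.

Lemma u_valP k (P Q : u) : mx (k *: P + Q) = (k%:C)%C *: mx P + mx Q.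
Proof. by rewrite linearP. Qed.

Lemma su_valD (P Q : su) : mx (P + Q) = mx P + mx Q.
Proof. by rewrite raddfD. Qed.

Lemma u_valD (P Q : u) : mx (P + Q) = mx P + mx Q.
Proof. by rewrite raddfD. Qed.

Lemma su_val0 : mx (0 : su) = 0.
Proof. by rewrite raddf0. Qed.

Lemma u_val0 : mx (0 : u) = 0.
Proof. by rewrite raddf0. Qed.

Lemma su_valN (P : su) : mx (- P) = - mx P.
Proof. by rewrite raddfN. Qed.

Lemma u_valN (P : u) : mx (- P) = - mx P.
Proof. by rewrite raddfN. Qed.

Lemma su_val_skew (P : su) : mx P ^t* = - mx P.
Proof. exact/skew_hermitianP/(su_u_subproof P). Qed.

Lemma su_val_tr0 (P : su) : \tr (mx P) = 0.
Proof. by case: P => P /= /andP[_ /eqP]. Qed.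

Lemma u_val_skew (B : u) : mx B ^t* = - mx B.
Proof. exact/skew_hermitianP/(valP B). Qed.

Lemma su_bracketE (P Q : su) : mx (su_bracket P Q) = mxbr hinv (mx P) (mx Q).
Proof. by rewrite /su_bracket linearZ. Qed.

Lemma rhoE (P : su) (B : u) : mx (rho P B) = mxbr hinv (mx P) (mx B).
Proof. by rewrite /rho linearZ. Qed.

Lemma b_cocycleE (P Q : su) : mx (b_cocycle P Q) = - mxbr hinv (mx P) (mx Q).
Proof. by rewrite /b_cocycle linearN linearZ. Qed.

Lemma su_bracket_lie : is_lie_bracket (@su_bracket R n).
Proof.
split; first split.
- move=> P k Q Q'; apply: val_inj.
  by rewrite !(su_bracketE, su_valP) mxbr_linear.
- move=> P k Q Q'; apply: val_inj.
  by rewrite !(su_bracketE, su_valP) mxbr_linear_l.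
- by move=> P; apply: val_inj; rewrite su_bracketE mxbrxx raddf0.
- move=> P Q T; apply: val_inj.
  by rewrite !su_valD !su_bracketE mxbr_jacobi raddf0.
Qed.

Lemma rho_lie_action : is_lie_action (@su_bracket R n) (@rho R n).
Proof.
split; first split.
- move=> P k B B'; apply: val_inj.
  by rewrite !(rhoE, u_valP) mxbr_linear.
- move=> B k P P'; apply: val_inj.
  by rewrite !(rhoE, u_valP, su_valP) mxbr_linear_l.
- move=> P Q B; apply: val_inj.
  by rewrite u_valD u_valN !(rhoE, su_bracketE) mxbr_leibniz.
Qed.

Lemma b_cocycle_alternating (P : su) : b_cocycle P P = 0.
Proof. by apply: val_inj; rewrite b_cocycleE mxbrxx oppr0 raddf0. Qed.

Lemma b_cocycle_2cocycle :
  is_2cocycle (@su_bracket R n) (@rho R n) (@b_cocycle R n).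
Proof.
split; first split.
- move=> P k Q Q'; apply: val_inj.
  by rewrite !(b_cocycleE, u_valP, su_valP) mxbr_linear opprD scalerN.
- move=> P k Q Q'; apply: val_inj.
  by rewrite !(b_cocycleE, u_valP, su_valP) mxbr_linear_l opprD scalerN.
- move=> P Q; apply: val_inj.
  by rewrite b_cocycleE mxbrC u_valN b_cocycleE.
- move=> P Q T; apply: val_inj.
  rewrite 4!u_valD 3!rhoE 6!b_cocycleE 3!su_bracketE.
  exact: mxbr_cocycle.
Qed.

Lemma ext_bracket_lie : is_lie_bracket (@ext_bracket R n).
Proof.
apply: abelian_ext_lie_bracket; [exact: su_bracket_lie | exact: rho_lie_action |
  exact: b_cocycle_2cocycle | exact: b_cocycle_alternating].
Qed.

Lemma ip_formulaE (v w : su * u) :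
  ip_formula v w = form (mx v.1) (mx v.2) (mx w.1) (mx w.2).
Proof. by rewrite /ip_formula hoppe_yauE. Qed.

Lemma ipE (v w : su * u) : ((ip v w)%:C)%C = ip_formula v w.
Proof.
apply: RRe_real; rewrite ip_formulaE; apply: energy_form_real;
  [exact: spin_matrix_skew | exact: su_val_skew | exact: u_val_skew |
   exact: su_val_skew | exact: u_val_skew].
Qed.

Lemma ipC (v w : su * u) : ip v w = ip w v.
Proof. by apply: complexI; rewrite 2!ipE 2!ip_formulaE; exact: energy_formC. Qed.

Lemma ip_linear (v : su * u) : linear (ip v : su * u -> R^o).
Proof.
move=> k w x; apply: complexI; rewrite rmorphD rmorphM /= 3!ipE 3!ip_formulaE.
by rewrite su_valP u_valP; exact: energy_form_linear.
Qed.

Hypothesis n_gt0 : (0 < n)%N.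

Let irr (A : M) (cA : forall i, mxcomm (spin_matrix R n i) A = 0) :=
  spin_matrix_irr n_gt0 cA.

Lemma ip_gt0 (v : su * u) : v != 0 -> 0 < ip v v.
Proof.
move=> v_neq0; rewrite -ltcR ipE ip_formulaE lt_neqAle.
have skew1 := su_val_skew v.1; have skew2 := u_val_skew v.2.
rewrite (energy_form_ge0 (@spin_matrix_skew R n) skew1 skew2) andbT eq_sym.
apply: contra v_neq0 => /eqP.
case/(energy_form_eq0 (@spin_matrix_skew R n) n_gt0 irr skew1 skew2 (su_val_tr0 v.1)).
move=> v1 v2; apply/eqP; rewrite [v]surjective_pairing.
by congr (_, _); apply: val_inj; rewrite ?v1 ?v2 raddf0.
Qed.

Lemma ip_inner_product : is_inner_product (@ip R n).
Proof.
split; [split|exact: ipC|exact: ip_gt0] => [v|w]; first exact: ip_linear.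
by move=> k v x; rewrite !(ipC _ w) ip_linear.
Qed.

Lemma laplacian_su_onto (Z : M) : Z ^t* = - Z -> \tr Z = 0 ->
  exists P : su, L (mx P) = Z.
Proof.
move=> skZ trZ.
have [A [LA skA trA]] := laplacian_onto_skew (@spin_matrix_skew R n) n_gt0 irr skZ trZ.
have Asu : (A : cmx R n) \in @skew_hermitian_tr0 R n.
  by apply/andP; split; [exact/skew_hermitianP | exact/eqP].
by exists (SuMx Asu).
Qed.

Lemma laplacian_su_inj0 (P : su) : L (mx P) = 0 -> P = 0.
Proof.
move=> LP; apply: val_inj; rewrite raddf0.
exact: (laplacian_inj0 (@spin_matrix_skew R n) n_gt0 irr (su_val_tr0 P) LP).
Qed.

(** The linear equations for [m] that express [m = ad_star v w]; the first one
    determines [m.1] because the Laplacian is invertible on su(n). *)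
Definition is_ad_star_value (v w m : su * u) : Prop :=
  L (mx m.1) = hinv *: (mxcomm (mx v.1) (L (mx w.1) + mx w.2)
                        + mxcomm (mx w.2) (mx v.2)) /\
  mx m.2 = mxbr hinv (mx v.1) (mx w.2).

Lemma is_ad_star_value_ip v w m : is_ad_star_value v w m ->
  forall x, ip m x = ip w (ad (@ext_bracket R n) v x).
Proof.
move=> [m1 m2] x; apply: complexI; rewrite 2!ipE 2!ip_formulaE.
have -> : mx (ad (@ext_bracket R n) v x).1 = - mxbr hinv (mx v.1) (mx x.1).
  by rewrite su_valN su_bracketE.
have -> : mx (ad (@ext_bracket R n) v x).2 =
    - (mxbr hinv (mx v.1) (mx x.2) - mxbr hinv (mx x.1) (mx v.2)
       - mxbr hinv (mx v.1) (mx x.1)).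
  by rewrite u_valN 2!u_valD u_valN 2!rhoE b_cocycleE.
exact: energy_form_ad_star m1 m2.
Qed.

Lemma ex_ad_star_value v w : exists m, is_ad_star_value v w m.
Proof.
have hinv_real : hinv \is Num.real by rewrite complex_real.
have [skZ trZ] := ad_star_target_skew (@spin_matrix_skew R n) hinv_real
  (su_val_skew v.1) (u_val_skew v.2) (su_val_skew w.1) (u_val_skew w.2).
have [P LP] := laplacian_su_onto skZ trZ.
by exists (P, rho v.1 w.2); split; [exact: LP | exact: rhoE].
Qed.

Lemma ex_ad_star : exists adstar, is_ad_star (@ip R n) (@ext_bracket R n) adstar.
Proof.
have /choice[f fP] : forall vw : (su * u) * (su * u),
  exists m, is_ad_star_value vw.1 vw.2 m by move=> vw; exact: ex_ad_star_value.
by exists (fun v w => f (v, w)) => v w x; exact: is_ad_star_value_ip (fP (v, w)) x.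
Qed.

(** The inner product separates points, so every operator with the defining property
    of the coadjoint takes the values found above. *)
Lemma ad_star_value adstar v w :
  is_ad_star (@ip R n) (@ext_bracket R n) adstar ->
  is_ad_star_value v w (adstar v w).
Proof.
move=> adP; have [m mP] := ex_ad_star_value v w.
suff -> : adstar v w = m by [].
apply: (inner_product_inj ip_inner_product) => x.
by rewrite adP (is_ad_star_value_ip mP).
Qed.

Lemma velocity_equationE (dP P : su) (B : u) :
  hoppe_yau dP + (hbar R n)^-1 *: commutator P (hoppe_yau P + (B : cmx R n)) =
  L (mx dP) + hinv *: mxcomm (mx P) (L (mx P) + mx B) :> M.
Proof. by rewrite cmx_scaleE -2!hoppe_yauE. Qed.

Lemma magnetic_equationE (dB B : u) (P : su) :
  (dB : cmx R n) + (hbar R n)^-1 *: commutator P B =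
  mx dB + mxbr hinv (mx P) (mx B) :> M.
Proof. by rewrite cmx_scaleE. Qed.

(** On the diagonal the term [mxcomm B B] of the coadjoint operator disappears, and
    applying the injective Laplacian to the first component of the Euler--Arnold
    equation loses nothing. *)
Lemma euler_arnold_pointwise (dP P : su) (dB B : u) m :
  is_ad_star_value (P, B) (P, B) m ->
  (dP, dB) + m = 0 <->
  hoppe_yau dP + (hbar R n)^-1 *: commutator P (hoppe_yau P + (B : cmx R n)) = 0 /\
  (dB : cmx R n) + (hbar R n)^-1 *: commutator P B = 0.
Proof.
move=> [m1 m2].
have {}m1 : L (mx m.1) = hinv *: (mxcomm (mx P) (L (mx P) + mx B)
  + mxcomm (mx B) (mx B)) := m1.
have {}m2 : mx m.2 = mxbr hinv (mx P) (mx B) := m2.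
have E1 : L (mx (dP + m.1)) =
    L (mx dP) + hinv *: mxcomm (mx P) (L (mx P) + mx B).
  by rewrite su_valD laplacianD m1 mxcommxx addr0.
have E2 : mx (dB + m.2) = mx dB + mxbr hinv (mx P) (mx B).
  by rewrite -m2; exact: u_valD.
split=> [dm|].
  have dm1 : dP + m.1 = 0 := congr1 fst dm; have dm2 : dB + m.2 = 0 := congr1 snd dm.
  rewrite velocity_equationE magnetic_equationE -E1 -E2 dm1 dm2.
  by rewrite su_val0 u_val0 laplacian0.
rewrite velocity_equationE magnetic_equationE -E1 -E2 => -[/laplacian_su_inj0 d1 d2].
have d2' : dB + m.2 = 0 by apply: val_inj; rewrite d2 raddf0.
by rewrite [m]surjective_pairing; congr (_, _).
Qed.

End Extension.

Unset Implicit Arguments.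

Theorem theorem1 (R : realType) (n : nat) (hn : (2 <= n)%N) :
  [/\ is_lie_bracket (@su_bracket R n),
      is_lie_action (@su_bracket R n) (@rho R n),
      is_2cocycle (@su_bracket R n) (@rho R n) (@b_cocycle R n)
    & is_lie_bracket (@ext_bracket R n)] /\
  (forall u v : su_mx R n * u_mx R n, ((ip u v)%:C)%C = ip_formula u v) /\
  is_inner_product (@ip R n) /\
  (exists adstar : su_mx R n * u_mx R n -> su_mx R n * u_mx R n ->
      su_mx R n * u_mx R n,
    is_ad_star (@ip R n) (@ext_bracket R n) adstar) /\
  (forall adstar : su_mx R n * u_mx R n -> su_mx R n * u_mx R n ->
      su_mx R n * u_mx R n,
    is_ad_star (@ip R n) (@ext_bracket R n) adstar ->
    forall (I : set R), open I -> is_interval I ->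
    forall (P : R -> su_mx R n) (B : R -> u_mx R n),
      euler_arnold adstar I (fun t => (P t, B t)) <->
      (forall t, I t ->
        [/\ derivable P t 1, derivable B t 1,
            hoppe_yau (derive1 P t)
              + (hbar R n)^-1 *: commutator (P t) (hoppe_yau (P t) + (B t : cmx R n)) = 0
          & (derive1 B t : cmx R n) + (hbar R n)^-1 *: commutator (P t) (B t) = 0])).
Proof.
have n_gt0 : (0 < n)%N := ltnW hn.
split; first by split; [exact: su_bracket_lie | exact: rho_lie_action |
  exact: b_cocycle_2cocycle | exact: ext_bracket_lie].
split; first exact: ipE.
split; first exact: ip_inner_product.
split; first exact: ex_ad_star.
move=> adstar adP I _ _ P B; split=> [EA t It|EA t It].
  have [/derivable_pairP[dP dB] eqEA] := EA t It.
  move: eqEA; rewrite derive1_pair //.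
  by move/(euler_arnold_pointwise n_gt0 _ _ (ad_star_value n_gt0 _ _ adP)) => [].
have [dP dB eqP eqB] := EA t It; split; first exact/derivable_pairP.
rewrite derive1_pair //.
exact/(euler_arnold_pointwise n_gt0 _ _ (ad_star_value n_gt0 _ _ adP)).
Qed.
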